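(* Let $N\ge2$ and $m\ge2$ be integers. Consider the family, parametrized by $[x_1:\dots:x_m:z]\in\mathbb{P}^m$, of hypersurfaces in the torus $(\mathbb{C}^* )^{(N-1)(m-1)}$ with coordinates $Y_j^{(l)}$ ($1\le j\le N-1$, $1\le l\le m-1$) given by $$W_N^{(m)}(x_1,\dots,x_m,z)=z-\prod_{j=1}^{N-1}\left(1+\sum_{l=1}^{m-1}Y_j^{(l)}\right)\cdot\left(x_1+\sum_{l=1}^{m-1}\frac{x_{l+1}}{\prod_{j=1}^{N-1}Y_j^{(l)}}\right)=0.$$ Then its period $$\pi_N(x_1/z,\dots,x_m/z)=\frac{1}{(2\pi i)^{(N-1)(m-1)}}\oint_T\frac{1}{W_N^{(m)}(x_1/z,\dots,x_m/z,1)}\prod_{j,l}\frac{dY_j^{(l)}}{Y_j^{(l)}}$$ coincides with the power series $$\sum_{r=0}^\infty\ \sum_{j_1+\dots+j_m=r}\binom{r}{j_1,j_2,\dots,j_m}^N\frac{x_1^{j_1}x_2^{j_2}\cdots x_m^{j_m}}{z^r}$$ for $|x_1/z|,\dots,|x_m/z|$ sufficiently small.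
   Context: $T$ is a torus $\{|Y_j^{(l)}|=\epsilon_{j,l}\}$ with fixed radii $\epsilon_{j,l}>0$, the product of positively oriented circles; ''sufficiently small'' depends on these radii. $\binom{r}{j_1,\dots,j_m}=\frac{r!}{j_1!\cdots j_m!}$ with $j_i\ge0$. *)

(* Defs.v *)
From Stdlib Require Import Reals.
From Coquelicot Require Import Coquelicot.
From mathcomp Require Import ssreflect ssrfun ssrbool eqtype ssrnat seq choice.
From mathcomp Require Import fintype tuple finfun bigop.

Set Implicit Arguments.
Unset Strict Implicit.
Unset Printing Implicit Defensive.

Local Open Scope C_scope.

Notation "\csum_ ( i : T | P ) F" := (\big[Cplus/RtoC 0]_(i : T | P%B) F%C)
  (at level 41, F at level 41, i, T at level 50,
   format "\csum_ ( i : T | P ) F").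
Notation "\csum_ ( i < n ) F" := (\big[Cplus/RtoC 0]_(i < n) F%C)
  (at level 41, F at level 41, i, n at level 50,
   format "\csum_ ( i < n ) F").
Notation "\cprod_ ( i : T ) F" := (\big[Cmult/RtoC 1]_(i : T) F%C)
  (at level 36, F at level 36, i at level 50,
   format "\cprod_ ( i : T ) F").
Notation "\cprod_ ( i < n ) F" := (\big[Cmult/RtoC 1]_(i < n) F%C)
  (at level 36, F at level 36, i, n at level 50,
   format "\cprod_ ( i < n ) F").

Section TorusIntegral.

Definition circle_pt (r t : R) : C := RtoC r * (cos t, sin t).

(* f(Y) dY pulled back along Y = r e^(it), so that dY = i r e^(it) dt *)
Definition circle_form (r : R) (f : C -> C) (t : R) : C :=
  f (circle_pt r t) * (Ci * circle_pt r t).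

Definition circle_int (r : R) (f : C -> C) : C :=
  RInt (V := C_R_CompleteNormedModule) (circle_form r f) 0 (2 * PI).

Definition ex_circle_int (r : R) (f : C -> C) : Prop :=
  ex_RInt (V := C_R_NormedModule) (circle_form r f) 0 (2 * PI).

Variables (I : finType) (eps : I -> R).

Definition on_torus (Y : I -> C) : Prop := forall i, Cmod (Y i) = eps i.

(* Iterated contour integral over the coordinates listed in s, the other
   coordinates being kept at their values in Y. *)
Fixpoint iter_circle_int (F : (I -> C) -> C) (s : seq I) (Y : I -> C) : C :=
  if s is i :: s' then
    circle_int (eps i) (fun c => iter_circle_int F s' [eta Y with i |-> c])
  else F Y.

(* RInt is total: this says that each Riemann integral occurring in
   iter_circle_int exists. *)
Fixpoint ex_iter_circle_int (F : (I -> C) -> C) (s : seq I) (Y : I -> C)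
    : Prop :=
  if s is i :: s' then
    (forall t : R, (0 <= t <= 2 * PI)%R ->
       ex_iter_circle_int F s' [eta Y with i |-> circle_pt (eps i) t])
    /\ ex_circle_int (eps i)
         (fun c => iter_circle_int F s' [eta Y with i |-> c])
  else True.

(* The base point 0 is irrelevant: every coordinate gets overwritten. *)
Definition torus_int (F : (I -> C) -> C) : C :=
  iter_circle_int F (enum I) (fun=> RtoC 0).

Definition ex_torus_int (F : (I -> C) -> C) : Prop :=
  ex_iter_circle_int F (enum I) (fun=> RtoC 0).

End TorusIntegral.

Section Period.

Variables N m : nat.

(* Indices are shifted by one: the paper's Y_j^(l) is Y (j - 1, l - 1), and its
   x_k is the entry k - 1 of the tuple x. *)
Definition coord : finType := ('I_N.-1 * 'I_m.-1)%type.

Definition W (x : m.-tuple C) (z : C) (Y : coord -> C) : C :=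
  z - (\cprod_(j < N.-1) (1 + \csum_(l < m.-1) Y (j, l)))
      * (nth (RtoC 0) x 0
         + \csum_(l < m.-1)
             (nth (RtoC 0) x l.+1 / \cprod_(j < N.-1) Y (j, l))).

Definition period_integrand (u : m.-tuple C) (Y : coord -> C) : C :=
  / W u 1 Y * \cprod_(i : coord) / Y i.

Definition period (eps : coord -> R) (u : m.-tuple C) : C :=
  / (2 * PI * Ci) ^ (N.-1 * m.-1)%N * torus_int eps (period_integrand u).

Definition multinom (r : nat) (j : {ffun 'I_m -> 'I_r.+1}) : R :=
  (INR r`! / INR (\prod_(k < m) (j k)`!)%N)%R.

(* Each exponent of a decomposition j_1 + ... + j_m = r is at most r, so the
   decompositions all lie in the finite type {ffun 'I_m -> 'I_r.+1}. *)
Definition period_term (x : m.-tuple C) (z : C) (r : nat) : C :=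
  \csum_(j : {ffun 'I_m -> 'I_r.+1} | (\sum_(k < m) j k == r)%N)
    (RtoC (multinom j) ^ N * ((\cprod_(k < m) tnth x k ^ j k) / z ^ r)).

End Period.

(* Main.v *)
(* Write W(u, 1, Y) = 1 - P(Y), where P is the product of the factors
   1 + sum_l Y_j^(l) and of u_1 + sum_l u_{l+1} / prod_j Y_j^(l).  On the torus
   |P| is at most a constant times max |u_k|, hence at most 1/2 for small u, so
   that the geometric series of 1 / (1 - P) converges uniformly there and may be
   integrated term by term.  By the multinomial theorem P^r is a sum of Laurent
   monomials, and only the constant ones survive integration: the exponent
   vectors chosen in the N - 1 factors must all equal the one chosen in the last
   factor, which gives the N-th powers of the multinomial coefficients. *)
From HB Require Import structures.
Require Import Defs.
From Stdlib Require Import Reals Lra FunctionalExtensionality.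
From Coquelicot Require Import Coquelicot.
From mathcomp Require Import ssreflect ssrfun ssrbool eqtype ssrnat seq choice.
From mathcomp Require Import fintype tuple finfun bigop.

Set Implicit Arguments.
Unset Strict Implicit.
Unset Printing Implicit Defensive.

Local Open Scope C_scope.

HB.instance Definition _ := Monoid.isComLaw.Build C (RtoC 0) Cplus
  Cplus_assoc Cplus_comm Cplus_0_l.
HB.instance Definition _ := Monoid.isComLaw.Build C (RtoC 1) Cmult
  Cmult_assoc Cmult_comm Cmult_1_l.
HB.instance Definition _ := Monoid.isMulLaw.Build C (RtoC 0) Cmult
  Cmult_0_l Cmult_0_r.
HB.instance Definition _ := Monoid.isAddLaw.Build C Cmult Cplus
  Cmult_plus_distr_r Cmult_plus_distr_l.

(** * Integrals over a circle *)

Local Notation is_CInt f v :=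
  (is_RInt (V := C_R_NormedModule) f 0%R (2 * PI)%R v).

Lemma is_CInt_plus (f g : R -> C) (v w : C) :
  is_CInt f v -> is_CInt g w -> is_CInt (fun t => f t + g t) (v + w).
Proof. exact: is_RInt_plus. Qed.

(** The module structure on [C] is the real one, so a complex scalar is handled through components:
    the real and imaginary parts of [c * f] are real combinations of those of [f]. *)
Lemma is_CInt_scal (c : C) (f : R -> C) (v : C) :
  is_CInt f v -> is_CInt (fun t => c * f t) (c * v).
Proof.
move=> H.
have H1 := is_RInt_fct_extend_fst (U := R_NormedModule) (V := R_NormedModule) _ _ _ _ H.
have H2 := is_RInt_fct_extend_snd (U := R_NormedModule) (V := R_NormedModule) _ _ _ _ H.
apply: (is_RInt_fct_extend_pair (U := R_NormedModule) (V := R_NormedModule)).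
- by apply: is_RInt_minus; apply: is_RInt_scal.
- by apply: is_RInt_plus; apply: is_RInt_scal.
Qed.

Lemma is_CInt_unique (f : R -> C) (v : C) :
  is_CInt f v -> RInt (V := C_R_CompleteNormedModule) f 0 (2 * PI) = v.
Proof. by move=> H; apply: is_RInt_unique. Qed.

Lemma is_CInt_correct (f : R -> C) :
  ex_RInt (V := C_R_NormedModule) f 0 (2 * PI) ->
  is_CInt f (RInt (V := C_R_CompleteNormedModule) f 0 (2 * PI)).
Proof. move=> H; exact: (RInt_correct (V := C_R_CompleteNormedModule)). Qed.

Lemma is_CInt_ext (f g : R -> C) (v : C) :
  (forall t, (0 <= t <= 2 * PI)%R -> f t = g t) -> is_CInt f v -> is_CInt g v.
Proof.
move=> fg; apply: is_RInt_ext => t; have PI0 := PI_RGT_0.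
rewrite Rmin_left ?Rmax_right; [|lra|lra] => ht; apply: fg; lra.
Qed.

Lemma is_CInt_bound (f : R -> C) (v : C) (M : R) :
  (forall t, Cmod (f t) <= M)%R -> is_CInt f v -> (Cmod v <= 2 * PI * M)%R.
Proof.
move=> fM fv; have PI0 := PI_RGT_0.
rewrite Cmod_norm.
have := @norm_RInt_le_const C_R_NormedModule f 0%R (2 * PI)%R v M.
rewrite Rminus_0_r; apply=> //; first lra.
by move=> x _; rewrite -Cmod_norm.
Qed.

(** Uniform convergence makes the limit integrable. Only existence is extracted; the values are
    compared later through [is_CInt_bound]. *)
Lemma filterlim_CInt (f : nat -> R -> C) (v : nat -> C) (g : R -> C) :
  (forall n, is_CInt (f n) (v n)) ->
  (forall e, (0 < e)%R ->
     exists n0, forall n, (n0 <= n)%N -> forall t, (Cmod (f n t - g t) < e)%R) ->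
  exists w, is_CInt g w.
Proof.
move=> fv fg.
have [w [_ ?]] : exists If : C_R_CompleteNormedModule,
    filterlim v eventually (locally If) /\ is_CInt g If; last by exists w.
apply: (@filterlim_RInt nat C_R_CompleteNormedModule f _ _ _ _ g v) => //.
apply/filterlim_locally => e.
have [n0 Hn0] := fg e (cond_pos e).
exists n0 => n /leP n0n t.
apply: (norm_compat1 (V := C_R_NormedModule)).
by have := Hn0 _ n0n t; rewrite Cmod_norm.
Qed.

Lemma expi_pow (t : R) (n : nat) :
  (cos t, sin t) ^ n = (cos (INR n * t), sin (INR n * t)).
Proof.
elim: n => [|n IHn]; first by rewrite /= Rmult_0_l cos_0 sin_0.
rewrite Cpow_S IHn S_INR Rmult_plus_distr_r Rmult_1_l Rplus_comm cos_plus sin_plus.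
by rewrite /Cmult /=; f_equal; ring.
Qed.

Lemma Cmod_expi (t : R) : Cmod (cos t, sin t) = 1%R.
Proof.
rewrite /Cmod -[RHS]sqrt_1; f_equal => /=.
have := sin2_cos2 t; rewrite /Rsqr; lra.
Qed.

Lemma Cmod_circle_pt (r t : R) : (0 < r)%R -> Cmod (circle_pt r t) = r.
Proof.
by move=> r0; rewrite Cmod_mult Cmod_expi Cmod_R Rabs_pos_eq ?Rmult_1_r; lra.
Qed.

(** The components have antiderivatives sin(kt)/k and -cos(kt)/k, and the hypotheses make these
    agree at both ends. They stand in for integrality of [k], kept real because it will be a
    possibly negative difference of exponents. *)
Lemma is_CInt_cos_sin (k : R) : k <> 0%R -> sin (k * (2 * PI)) = 0%R ->
  cos (k * (2 * PI)) = 1%R -> is_CInt (fun t => (cos (k * t), sin (k * t))) (RtoC 0).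
Proof.
move=> k0 sk ck.
apply: (is_RInt_fct_extend_pair (U := R_NormedModule) (V := R_NormedModule)).
- have E0 : minus (sin (k * (2 * PI)) / k)%R (sin (k * 0) / k)%R = 0%R.
    by rewrite sk Rmult_0_r sin_0 /minus /plus /opp /=; field.
  rewrite -[X in is_RInt _ _ _ X]E0.
  apply: (is_RInt_derive (V := R_CompleteNormedModule)
            (fun t => sin (k * t) / k)%R) => t _.
    by auto_derive=> //=; field.
  by apply: (ex_derive_continuous (fun t => cos (k * t))); auto_derive.
- have E0 : minus (- cos (k * (2 * PI)) / k)%R (- cos (k * 0) / k)%R = 0%R.
    by rewrite ck Rmult_0_r cos_0 /minus /plus /opp /=; field.
  rewrite -[X in is_RInt _ _ _ X]E0.
  apply: (is_RInt_derive (V := R_CompleteNormedModule)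
            (fun t => - cos (k * t) / k)%R) => t _.
    by auto_derive=> //=; field.
  by apply: (ex_derive_continuous (fun t => sin (k * t))); auto_derive.
Qed.

(** One coordinate of a Laurent monomial, with the kernel [/ y] of dY/Y included; two natural
    exponents encode the integer a - b. *)
Definition monomial_form (a b : nat) (y : C) : C := y ^ a * (/ y) ^ b * / y.

(** Since dy = iy dt cancels the kernel, the pulled-back form is a constant times e^(i(a-b)t), whose
    mean over a full turn vanishes unless the frequency is zero. *)
Lemma is_CInt_monomial_form (r : R) (a b : nat) : (0 < r)%R ->
  is_CInt (circle_form r (monomial_form a b))
          (if a == b then 2 * PI * Ci else 0)%C.
Proof.
move=> r0.
have rC : RtoC r <> 0 by move=> /RtoC_inj; lra.
pose k := (INR a - INR b)%R.
have e0 t : (cos t, sin t) <> RtoC 0.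
  by move=> h; have := Cmod_expi t; rewrite h Cmod_0; lra.
have E t : circle_form r (monomial_form a b) t =
    Ci * r ^ a * (/ RtoC r) ^ b * (cos (k * t), sin (k * t)).
  rewrite /circle_form /monomial_form /circle_pt.
  have -> : (cos (k * t), sin (k * t)) = (cos t, sin t) ^ a * (/ (cos t, sin t)) ^ b.
    have -> : / (cos t, sin t) = (cos (- t), sin (- t)).
      rewrite cos_neg sin_neg /Cinv /=.
      have -> : (cos t * (cos t * 1) + sin t * (sin t * 1) = 1)%R.
        by have := sin2_cos2 t; rewrite /Rsqr; lra.
      by f_equal; field.
    rewrite !expi_pow /Cmult /= /k.
    have -> : ((INR a - INR b) * t = INR a * t + INR b * (- t))%R by ring.
    by rewrite cos_plus sin_plus; f_equal; ring.
  rewrite !Cpow_inv // ?Cpow_mult_l; last exact: Cmult_neq_0.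
  have := Cpow_nz _ b rC; have := Cpow_nz _ b (e0 t); have := e0 t.
  move: (cos t, sin t) => e h1 h2 h3; field; repeat split=> //.
apply: (is_CInt_ext (f := fun t =>
  Ci * r ^ a * (/ RtoC r) ^ b * (cos (k * t), sin (k * t)))).
  by move=> t _; rewrite E.
case: eqP => [ab|ab].
  have -> : 2 * PI * Ci = Ci * r ^ a * (/ RtoC r) ^ b * (2 * PI).
    by rewrite ab Cpow_inv //; field; apply: Cpow_nz.
  apply: is_CInt_scal.
  apply: (is_CInt_ext (f := fun t => RtoC 1)).
    by move=> t _; rewrite /k ab Rminus_diag Rmult_0_l cos_0 sin_0.
  have := is_RInt_const (V := C_R_NormedModule) 0%R (2 * PI)%R (RtoC 1).
  by rewrite Rminus_0_r scal_R_Cmult Cmult_1_r RtoC_mult.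
rewrite -[X in is_CInt _ X](Cmult_0_r (Ci * r ^ a * (/ RtoC r) ^ b)).
apply: is_CInt_scal; apply: is_CInt_cos_sin.
- by move=> h; apply: ab; apply: INR_eq; rewrite /k in h; lra.
(* The frequency is a difference of naturals, so the addition formulas reduce everything to whole
   multiples of 2 pi. *)
- have P n : sin (INR n * (2 * PI)) = 0%R.
    by rewrite -[RHS]sin_0 -(sin_period 0 n); f_equal; ring.
  by rewrite /k Rmult_minus_distr_r sin_minus !P; ring.
- have P n : sin (INR n * (2 * PI)) = 0%R.
    by rewrite -[RHS]sin_0 -(sin_period 0 n); f_equal; ring.
  have Q n : cos (INR n * (2 * PI)) = 1%R.
    by rewrite -[RHS]cos_0 -(cos_period 0 n); f_equal; ring.
  by rewrite /k Rmult_minus_distr_r cos_minus !P !Q; ring.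
Qed.

(** * Iterated integrals *)

Section IteratedIntegral.

Variables (I : finType) (eps : I -> R).
Hypothesis eps_gt0 : forall i, (0 < eps i)%R.

(** [RInt] is total, so a value alone proves no integrability; carrying existence along lets each
    induction deliver both. *)
Definition is_iter_circle_int (F : (I -> C) -> C) (s : seq I) (Y : I -> C)
    (v : C) : Prop :=
  ex_iter_circle_int eps F s Y /\ iter_circle_int eps F s Y = v.

(** Only points of the circle are visited, so any closed form [g] of the inner integral that is
    valid there suffices. *)
Lemma is_iter_circle_int_cons (F : (I -> C) -> C) (i : I) (s : seq I)
    (Y : I -> C) (g : C -> C) (v : C) :
  (forall t, (0 <= t <= 2 * PI)%R ->
     is_iter_circle_int F s [eta Y with i |-> circle_pt (eps i) t]
       (g (circle_pt (eps i) t))) ->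
  is_CInt (circle_form (eps i) g) v ->
  is_iter_circle_int F (i :: s) Y v.
Proof.
move=> HF Hg.
have H : is_CInt (circle_form (eps i)
    (fun c => iter_circle_int eps F s [eta Y with i |-> c])) v.
  apply: is_CInt_ext Hg => t ht.
  by rewrite /circle_form (HF t ht).2.
split; last exact: is_CInt_unique.
split; last by exists v.
by move=> t /HF [].
Qed.

Lemma is_iter_circle_int_cons_inv (F : (I -> C) -> C) (i : I) (s : seq I)
    (Y : I -> C) (v : C) :
  is_iter_circle_int F (i :: s) Y v ->
  exists2 g : C -> C,
    forall t, (0 <= t <= 2 * PI)%R ->
      is_iter_circle_int F s [eta Y with i |-> circle_pt (eps i) t]
        (g (circle_pt (eps i) t)) &
    is_CInt (circle_form (eps i) g) v.
Proof.
move=> [[HF Hex] <-].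
exists (fun c => iter_circle_int eps F s [eta Y with i |-> c]).
  by move=> t /HF.
exact: is_CInt_correct.
Qed.

Lemma is_iter_circle_int_plus (F G : (I -> C) -> C) (s : seq I) (Y : I -> C)
    (v w : C) :
  is_iter_circle_int F s Y v -> is_iter_circle_int G s Y w ->
  is_iter_circle_int (fun Z => F Z + G Z) s Y (v + w).
Proof.
elim: s Y v w => [|i s IHs] Y v w; first by move=> [_ <-] [_ <-].
move=> /is_iter_circle_int_cons_inv[f Ff fv].
move=> /is_iter_circle_int_cons_inv[g Gg gw].
apply: (is_iter_circle_int_cons (g := fun c => f c + g c)).
  by move=> t ht; apply: IHs; [apply: Ff | apply: Gg].
apply: is_CInt_ext (is_CInt_plus fv gw) => t _.
by rewrite /circle_form; ring.
Qed.

Lemma is_iter_circle_int_scal (c : C) (F : (I -> C) -> C) (s : seq I)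
    (Y : I -> C) (v : C) :
  is_iter_circle_int F s Y v ->
  is_iter_circle_int (fun Z => c * F Z) s Y (c * v).
Proof.
elim: s Y v => [|i s IHs] Y v; first by move=> [_ <-].
move=> /is_iter_circle_int_cons_inv[f Ff fv].
apply: (is_iter_circle_int_cons (g := fun y => c * f y)).
  by move=> t ht; apply: IHs; apply: Ff.
apply: is_CInt_ext (is_CInt_scal (c := c) fv) => t _.
by rewrite /circle_form; ring.
Qed.

Lemma is_iter_circle_int0 (s : seq I) (Y : I -> C) :
  is_iter_circle_int (fun=> RtoC 0) s Y 0.
Proof.
elim: s Y => [|i s IHs] Y //.
apply: (is_iter_circle_int_cons (g := fun=> RtoC 0)).
  by move=> t _; apply: IHs.
have := is_RInt_const (V := C_R_NormedModule) 0%R (2 * PI)%R (RtoC 0).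
rewrite scal_R_Cmult Cmult_0_r => H; apply: is_CInt_ext H => t _.
by rewrite /circle_form Cmult_0_l.
Qed.

Lemma is_iter_circle_int_sum (J : Type) (r : seq J) (P : pred J)
    (F : J -> (I -> C) -> C) (s : seq I) (Y : I -> C) (v : J -> C) :
  (forall j, P j -> is_iter_circle_int (F j) s Y (v j)) ->
  is_iter_circle_int (fun Z => \big[Cplus/RtoC 0]_(j <- r | P j) F j Z) s Y
    (\big[Cplus/RtoC 0]_(j <- r | P j) v j).
Proof.
move=> FP.
elim: r => [|j r IHr].
  have -> : (fun Z => \big[Cplus/RtoC 0]_(j <- [::] | P j) F j Z) = fun=> RtoC 0.
    by apply: functional_extensionality => Z; rewrite big_nil.
  rewrite big_nil; exact: is_iter_circle_int0.
have -> : (fun Z => \big[Cplus/RtoC 0]_(j <- j :: r | P j) F j Z) =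
    fun Z => if P j then F j Z + \big[Cplus/RtoC 0]_(j <- r | P j) F j Z
             else \big[Cplus/RtoC 0]_(j <- r | P j) F j Z.
  by apply: functional_extensionality => Z; rewrite big_cons.
rewrite big_cons; case: ifP => Pj //.
by apply: is_iter_circle_int_plus => //; apply: FP.
Qed.

(** Each integration sees the other factors as constants. The mixed product is the induction
    invariant: coordinates outside [s] are still frozen at [Y], and [uniq s] prevents a coordinate
    from being overwritten again. *)
Lemma is_iter_circle_int_prod (g : I -> C -> C) (l : I -> C) (s : seq I)
    (Y : I -> C) :
  uniq s -> (forall i, is_CInt (circle_form (eps i) (g i)) (l i)) ->
  is_iter_circle_int (fun Z => \big[Cmult/RtoC 1]_i g i (Z i)) s Y
    (\big[Cmult/RtoC 1]_i (if i \in s then l i else g i (Y i))).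
Proof.
move=> us gl; elim: s Y us => [|i s IHs] Y.
  by move=> _; split.
move=> /= /andP[nis us].
pose q := \big[Cmult/RtoC 1]_(k | k != i) (if k \in s then l k else g k (Y k)).
apply: (is_iter_circle_int_cons (g := fun c => g i c * q)).
  move=> t ht; have := IHs [eta Y with i |-> circle_pt (eps i) t] us.
  rewrite (bigD1 i) //= (negbTE nis) eqxx.
  rewrite (eq_bigr (fun k => if k \in s then l k else g k (Y k))) //.
  by move=> k /negbTE ->.
rewrite (bigD1 i) //= inE eqxx /=.
rewrite (eq_bigr (fun k => if k \in s then l k else g k (Y k))) -/q; last first.
  by move=> k /negbTE ki; rewrite inE ki.
rewrite Cmult_comm; apply: is_CInt_ext (is_CInt_scal (c := q) (gl i)) => t _.
by rewrite /circle_form; ring.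
Qed.

(* The coordinates outside [s] are those already moved to the torus when
   [iter_circle_int] reaches [s]. *)
Definition on_torus_off (s : seq I) (Y : I -> C) : Prop :=
  forall i, i \notin s -> Cmod (Y i) = eps i.

Lemma on_torus_off_circle_pt (i : I) (s : seq I) (Y : I -> C) (t : R) :
  on_torus_off (i :: s) Y ->
  on_torus_off s [eta Y with i |-> circle_pt (eps i) t].
Proof.
move=> offY k ks /=; case: eqP => [->|/eqP ki]; first exact: Cmod_circle_pt.
by apply: offY; rewrite inE negb_or ki.
Qed.

(** Induction on [s], innermost integral first. The estimate is uniform in the coordinates outside
    [s], which are already on their circles, so the next integrand again converges uniformly and its
    limit is integrable. *)
Lemma is_iter_circle_int_uniform_limit (Fn : nat -> (I -> C) -> C)
    (F : (I -> C) -> C) :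
  (forall n s Y, uniq s -> ex_iter_circle_int eps (Fn n) s Y) ->
  (forall e, (0 < e)%R -> exists n0, forall n, (n0 <= n)%N ->
     forall Y, on_torus eps Y -> (Cmod (Fn n Y - F Y) < e)%R) ->
  forall s, uniq s ->
  (forall Y, on_torus_off s Y -> ex_iter_circle_int eps F s Y) /\
  (forall e, (0 < e)%R -> exists n0, forall n, (n0 <= n)%N ->
     forall Y, on_torus_off s Y ->
     (Cmod (iter_circle_int eps (Fn n) s Y - iter_circle_int eps F s Y) < e)%R).
Proof.
move=> exFn FnF; elim=> [_|i s IHs /= /andP[nis us]].
  split=> // e /FnF[n0 Hn0]; exists n0 => n nn0 Y offY.
  by apply: Hn0 => // i; apply: offY.
have [exF limF] := IHs us.
have PI0 := PI_RGT_0; have ei0 := eps_gt0 i.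
pose f n Y := circle_form (eps i)
  (fun c => iter_circle_int eps (Fn n) s [eta Y with i |-> c]).
pose g Y := circle_form (eps i)
  (fun c => iter_circle_int eps F s [eta Y with i |-> c]).
have fg e : (0 < e)%R -> exists n0, forall n, (n0 <= n)%N ->
    forall Y, on_torus_off (i :: s) Y -> forall t, (Cmod (f n Y t - g Y t) < e)%R.
  (* The form carries the factor iY of modulus [eps i], hence the division of the tolerance. *)
  move=> e0; have [|n0 Hn0] := limF (e / eps i)%R.
    exact: Rdiv_lt_0_compat.
  exists n0 => n nn0 Y offY t.
  have := Hn0 n nn0 _ (on_torus_off_circle_pt t offY).
  set a := iter_circle_int _ _ _ _; set b := iter_circle_int _ _ _ _ => ab.
  have -> : f n Y t - g Y t = (a - b) * (Ci * circle_pt (eps i) t).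
    by rewrite /f /g /circle_form -/a -/b; ring.
  rewrite Cmod_mult (Cmod_mult Ci) Cmod_circle_pt // Cmod_Ci Rmult_1_l.
  have -> : e = (e / eps i * eps i)%R by field; lra.
  exact: Rmult_lt_compat_r.
have fint n Y : is_CInt (f n Y) (iter_circle_int eps (Fn n) (i :: s) Y).
  have [] : ex_iter_circle_int eps (Fn n) (i :: s) Y by apply: exFn; rewrite /= nis.
  by move=> _ /is_CInt_correct.
have gint Y : on_torus_off (i :: s) Y ->
    is_CInt (g Y) (iter_circle_int eps F (i :: s) Y).
  move=> offY.
  have [w gw] : exists w, is_CInt (g Y) w.
    apply: (filterlim_CInt (fun n => fint n Y)) => e e0.
    have [n0 Hn0] := fg _ e0.
    by exists n0 => n nn0 t; apply: Hn0.
  by apply: is_CInt_correct; exists w.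
split.
  move=> Y offY; split; last by exists (iter_circle_int eps F (i :: s) Y); apply: gint.
  by move=> t _; apply: exF; apply: on_torus_off_circle_pt.
(* An interval of length 2 pi turns this tolerance into e/2. *)
move=> e e0; have [|n0 Hn0] := fg (e / (4 * PI))%R.
  apply: Rdiv_lt_0_compat; lra.
exists n0 => n nn0 Y offY.
apply: (Rle_lt_trans _ (2 * PI * (e / (4 * PI)))%R).
  apply: (is_CInt_bound (f := fun t => f n Y t + (- (1)) * g Y t)).
    move=> t; apply: Rlt_le; have := Hn0 n nn0 Y offY t.
    by congr (Cmod _ < _)%R; ring.
  have -> : iter_circle_int eps (Fn n) (i :: s) Y - iter_circle_int eps F (i :: s) Y =
    iter_circle_int eps (Fn n) (i :: s) Y + (- (1)) * iter_circle_int eps F (i :: s) Y.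
    by ring.
  by apply: is_CInt_plus => //; apply: is_CInt_scal; apply: gint.
have -> : (2 * PI * (e / (4 * PI)) = e / 2)%R by field; lra.
lra.
Qed.

End IteratedIntegral.

(** * The multinomial theorem *)

Lemma RtoC_INR_prod (I : Type) (r : seq I) (F : I -> nat) :
  RtoC (INR (\prod_(i <- r) F i)%N) = \big[Cmult/RtoC 1]_(i <- r) RtoC (INR (F i)).
Proof.
apply: (big_morph (fun n => RtoC (INR n))) => // a b.
by rewrite -RtoC_mult -mult_INR.
Qed.

Lemma RtoC_INR_sum (I : Type) (r : seq I) (F : I -> nat) :
  RtoC (INR (\sum_(i <- r) F i)%N) = \big[Cplus/RtoC 0]_(i <- r) RtoC (INR (F i)).
Proof.
apply: (big_morph (fun n => RtoC (INR n))) => // a b.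
by rewrite -RtoC_plus -plus_INR.
Qed.

Lemma RtoC_INR_neq0 (n : nat) : (0 < n)%N -> RtoC (INR n) <> 0.
Proof. by move=> /ltP n0 /RtoC_inj; apply/not_0_INR/eqP; rewrite -lt0n; apply/ltP. Qed.

Lemma RtoC_fact_neq0 (n : nat) : RtoC (INR n`!) <> 0.
Proof. by apply: RtoC_INR_neq0; apply: fact_gt0. Qed.

Lemma cprod_neq0 (I : Type) (r : seq I) (F : I -> C) :
  (forall i, F i <> 0) -> \big[Cmult/RtoC 1]_(i <- r) F i <> 0.
Proof.
move=> F0; elim/big_rec: _ => [|i x _ x0]; first by move=> /RtoC_inj; lra.
exact: Cmult_neq_0.
Qed.

Lemma cprod_inv (I : Type) (r : seq I) (F : I -> C) : (forall i, F i <> 0) ->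
  \big[Cmult/RtoC 1]_(i <- r) / F i = / \big[Cmult/RtoC 1]_(i <- r) F i.
Proof.
move=> F0; elim: r => [|i r IHr]; first by rewrite !big_nil; field.
by rewrite !big_cons IHr; field; split=> //; apply: cprod_neq0.
Qed.

Section Multinomial.

Variables (m : nat) (a : 'I_m -> C).

(** A term of the product of the exponential series of the [a k]. The bound [K] is independent of
    the degree, so that consecutive degrees live in one finite type. *)
Definition divided_monomial (K : nat) (al : {ffun 'I_m -> 'I_K.+1}) : C :=
  \big[Cmult/RtoC 1]_k (a k ^ al k / RtoC (INR (al k)`!)).

(** From n x^n / n! = x * x^(n-1) / (n-1)!: lowering a positive [k]-th exponent is a bijection onto
    the vectors of weight [r], and [r < K] leaves room to raise it back. *)
Lemma sum_divided_monomial_weighted (K r : nat) (k : 'I_m) : (r < K)%N ->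
  \big[Cplus/RtoC 0]_(al : {ffun 'I_m -> 'I_K.+1} | (\sum_i al i == r.+1)%N)
    (RtoC (INR (al k)) * divided_monomial al) =
  a k * \big[Cplus/RtoC 0]_(al : {ffun 'I_m -> 'I_K.+1} | (\sum_i al i == r)%N)
          divided_monomial al.
Proof.
move=> rK.
(* Vectors with exponent 0 at [k] contribute 0 and cannot be lowered, so they are split off. *)
rewrite (bigID (fun al : {ffun 'I_m -> 'I_K.+1} => (0 < al k)%N)) /=.
rewrite [X in _ + X]big1 ?Cplus_0_r; last first.
  move=> al /andP[_]; rewrite -eqn0Ngt => /eqP ->; exact: Cmult_0_l.
pose h (be : {ffun 'I_m -> 'I_K.+1}) : {ffun 'I_m -> 'I_K.+1} :=
  [ffun i => if i == k then inord (be k).+1 else be i].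
pose h' (al : {ffun 'I_m -> 'I_K.+1}) : {ffun 'I_m -> 'I_K.+1} :=
  [ffun i => if i == k then inord (al k).-1 else al i].
rewrite (reindex_onto h h'); last first.
  move=> al /andP[_ alk]; apply/ffunP => i; rewrite !ffunE eqxx.
  have pk : ((al k).-1 < K.+1)%N by exact: leq_ltn_trans (leq_pred _) (ltn_ord _).
  by case: eqP => // ->; apply: val_inj; rewrite /= (inordK pk) prednK // inordK.
rewrite big_distrr /=; apply: eq_big => be.
  case: (ltnP (be k) K) => [bK|Kb].
    have hk : h be k = (be k).+1 :> nat by rewrite ffunE eqxx inordK.
    have -> : h' (h be) == be.
      apply/eqP/ffunP => i; rewrite ffunE hk ffunE.
      by case: eqP => // ->; apply: val_inj; rewrite /= inordK.
    rewrite hk andbT andbT !(bigD1 k (P := predT)) //= hk addSn eqSS.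
    rewrite (eq_bigr (fun i => be i : nat)) // => i /negbTE ik.
    by rewrite ffunE ik.
  (* At the top value [K] the weight exceeds [r], while [inord] falls back to 0 and violates
     positivity: both conditions fail. *)
  have -> : (\sum_i be i == r)%N = false.
    apply/negbTE; rewrite neq_ltn; apply/orP; right.
    by rewrite (bigD1 k) //=; apply: ltn_addr; apply: leq_trans Kb.
  have bek : be k = K :> nat by apply/eqP; rewrite eqn_leq Kb -ltnS ltn_ord.
  rewrite ffunE eqxx bek /inord /insubd insubF ?ltnn //=.
  by rewrite andbF.
case/andP => /andP[_ hk0] _.
have bK : (be k < K)%N.
  rewrite ltnNge; apply/negP => Kb; move: hk0.
  have bek : be k = K :> nat by apply/eqP; rewrite eqn_leq Kb -ltnS ltn_ord.
  by rewrite ffunE eqxx bek /inord /insubd insubF ?ltnn.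
have hk : h be k = (be k).+1 :> nat by rewrite ffunE eqxx inordK.
rewrite /divided_monomial !(bigD1 k (P := predT)) //= hk.
rewrite (eq_bigr (fun i => a i ^ be i / RtoC (INR (be i)`!))); last first.
  by move=> i /negbTE ik; rewrite ffunE ik.
rewrite factS mult_INR RtoC_mult Cpow_S.
have := @RtoC_fact_neq0 (be k); have := @RtoC_INR_neq0 (be k).+1 isT.
move=> h1 h2; field; split=> //.
Qed.

(** Summing the weighted identity over [k] replaces the weights by their sum [r.+1] (Euler's
    relation), so (r+1) S_(r+1) = (sum of the [a k]) S_r. *)
Lemma sum_divided_monomial (K r : nat) : (r <= K)%N ->
  \big[Cplus/RtoC 0]_(al : {ffun 'I_m -> 'I_K.+1} | (\sum_i al i == r)%N)
    divided_monomial al =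
  (\big[Cplus/RtoC 0]_k a k) ^ r / RtoC (INR r`!).
Proof.
elim: r => [_|r IHr rK].
  rewrite (big_pred1 [ffun=> ord0]) => [|al].
    rewrite /divided_monomial big1 => [|i _]; last by rewrite ffunE /=; field.
    by rewrite fact0 /=; field.
  rewrite sum_nat_eq0; apply/forallP/eqP => [al0|-> i]; last by rewrite ffunE.
  by apply/ffunP => i; rewrite ffunE; apply/val_inj/eqP/(implyP (al0 i)).
have r0 : RtoC (INR r.+1) <> 0 by exact: RtoC_INR_neq0.
have H c : c = RtoC (INR r.+1) -> c *
   \big[Cplus/RtoC 0]_(al : {ffun 'I_m -> 'I_K.+1} | (\sum_i al i == r.+1)%N)
    divided_monomial al =
   (\big[Cplus/RtoC 0]_k a k) *
   ((\big[Cplus/RtoC 0]_k a k) ^ r / RtoC (INR r`!)).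
  move=> cE; rewrite -IHr 1?ltnW // big_distrl /=.
  rewrite -(eq_bigr _ (fun k _ => sum_divided_monomial_weighted k rK)).
  rewrite exchange_big big_distrr; apply: eq_bigr => al /eqP alr.
  by rewrite cE -alr RtoC_INR_sum [LHS]big_distrl.
move: H; set S := bigop _ _ _ => H.
have -> : S = RtoC (INR r.+1) * S / RtoC (INR r.+1) by field.
rewrite H // factS mult_INR RtoC_mult Cpow_S; field; split=> //.
exact: RtoC_fact_neq0.
Qed.

Lemma multinomial_theorem (r : nat) :
  (\big[Cplus/RtoC 0]_k a k) ^ r =
  \big[Cplus/RtoC 0]_(al : {ffun 'I_m -> 'I_r.+1} | (\sum_i al i == r)%N)
    (RtoC (multinom al) * \big[Cmult/RtoC 1]_k a k ^ al k).
Proof.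
have r0 := @RtoC_fact_neq0 r.
have -> : (\big[Cplus/RtoC 0]_k a k) ^ r =
    RtoC (INR r`!) * ((\big[Cplus/RtoC 0]_k a k) ^ r / RtoC (INR r`!)) by field.
rewrite -(sum_divided_monomial (leqnn r)) big_distrr /=; apply: eq_bigr => al _.
have f0 := @cprod_neq0 _ (index_enum _) _ (fun k => @RtoC_fact_neq0 (al k)).
rewrite /divided_monomial big_split /= cprod_inv; last first.
  by move=> k; apply: RtoC_fact_neq0.
rewrite /multinom -RtoC_INR_prod RtoC_div ?RtoC_INR_prod; last first.
  by move=> h; apply: f0; rewrite -RtoC_INR_prod h.
by rewrite /Cdiv; ring.
Qed.

End Multinomial.

(** * Laurent expansion of the powers of the potential *)

Lemma cprod_const (n : nat) (c : C) : \cprod_(i < n) c = c ^ n.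
Proof. by elim: n => [|n IHn]; rewrite ?big_ord0 ?big_ord_recl ?IHn. Qed.

Lemma cprod_pow (I : Type) (s : seq I) (F : I -> C) (n : nat) :
  (\big[Cmult/RtoC 1]_(i <- s) F i) ^ n = \big[Cmult/RtoC 1]_(i <- s) F i ^ n.
Proof.
apply: (big_morph (fun x => x ^ n)); last exact: Cpow_1_l.
by move=> x y; apply: Cpow_mult_l.
Qed.

Section Potential.

Variables N M : nat.

Definition weight_pred (r : nat) : pred {ffun 'I_M.+1 -> 'I_r.+1} :=
  fun al => (\sum_k al k == r)%N.

(** The Laurent polynomial P with W(u, 1, Y) = 1 - P(Y); writing m as [M.+1] makes [m.-1] reduce to
    [M]. *)
Definition potential (u : M.+1.-tuple C) (Y : coord N M.+1 -> C) : C :=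
  (\cprod_(j < N.-1) (1 + \csum_(l < M) Y (j, l)))
  * (nth (RtoC 0) u 0
     + \csum_(l < M) (nth (RtoC 0) u l.+1 / \cprod_(j < N.-1) Y (j, l))).

(* The paper's convention [Y_j^(0) = 1], which makes both factors of the
   potential sums over [k <= M]. *)
Definition extended_coord (Y : coord N M.+1 -> C) (j : 'I_N.-1) (k : 'I_M.+1) : C :=
  if unlift ord0 k is Some l then Y (j, l) else 1.

Lemma extended_coord0 Y j : extended_coord Y j ord0 = 1.
Proof. by rewrite /extended_coord unlift_none. Qed.

Lemma extended_coord_lift Y j (l : 'I_M) :
  extended_coord Y j (lift ord0 l) = Y (j, l).
Proof. by rewrite /extended_coord liftK. Qed.

Lemma extended_coord_neq0 (Y : coord N M.+1 -> C) j k :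
  (forall i, Y i <> 0) -> extended_coord Y j k <> 0.
Proof.
rewrite /extended_coord => Y0; case: unlift => [l|]; first exact: Y0.
move=> /RtoC_inj; lra.
Qed.

Lemma potentialE (u : M.+1.-tuple C) (Y : coord N M.+1 -> C) : (forall i, Y i <> 0) ->
  potential u Y = (\cprod_(j < N.-1) \csum_(k < M.+1) extended_coord Y j k) *
    \csum_(k < M.+1) (tnth u k * \cprod_(j < N.-1) / extended_coord Y j k).
Proof.
move=> Y0; rewrite /potential; congr (_ * _).
  apply: eq_bigr => j _; rewrite big_ord_recl extended_coord0; congr (_ + _).
  by apply: eq_bigr => l _; rewrite extended_coord_lift.
rewrite big_ord_recl [X in _ = _ * X + _]big1 => [|j _]; last by rewrite extended_coord0; field.
rewrite Cmult_1_r (tnth_nth (RtoC 0)); congr (_ + _).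
apply: eq_bigr => l _; rewrite (tnth_nth (RtoC 0)) lift0 cprod_inv; last first.
  by move=> j; apply: extended_coord_neq0.
by congr (_ / _); apply: eq_bigr => j _; rewrite extended_coord_lift.
Qed.

(* With [D a b i = Y i ^ a / Y i ^ b / Y i] this is the expansion of
   [potential u Y ^ r / prod Y]; [A j] is the exponent vector chosen in the
   [j]-th factor and [be] that of the last one. *)
Definition laurent_sum (u : M.+1.-tuple C) (r : nat)
    (D : nat -> nat -> coord N M.+1 -> C) : C :=
  \csum_(be : {ffun 'I_M.+1 -> 'I_r.+1} | weight_pred be)
    (RtoC (multinom be) * (\cprod_(k < M.+1) tnth u k ^ be k) *
     \csum_(A : {ffun 'I_N.-1 -> {ffun 'I_M.+1 -> 'I_r.+1}} |
            A \in ffun_on (@weight_pred r))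
       ((\cprod_(j < N.-1) RtoC (multinom (A j))) *
        \cprod_(i : coord N M.+1)
          D (A i.1 (lift ord0 i.2)) (be (lift ord0 i.2)) i)).

(** Independent choices of exponent vectors in the N - 1 factors distribute. The expanded form suits
    integration; the factored one lets later computations treat one [j] at a time. *)
Lemma laurent_sum_factor u r D :
  laurent_sum u r D =
  \csum_(be : {ffun 'I_M.+1 -> 'I_r.+1} | weight_pred be)
    (RtoC (multinom be) * (\cprod_(k < M.+1) tnth u k ^ be k) *
     \cprod_(j < N.-1)
       \csum_(al : {ffun 'I_M.+1 -> 'I_r.+1} | weight_pred al)
         (RtoC (multinom al) *
          \cprod_(l < M) D (al (lift ord0 l)) (be (lift ord0 l)) (j, l))).
Proof.
apply: eq_bigr => be _; congr (_ * _).
rewrite bigA_distr_big; apply: eq_bigr => A _.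
rewrite big_split; congr (_ * _).
by rewrite pair_bigA; apply: eq_bigr => -[j l].
Qed.

(** The multinomial theorem is applied to the last factor and to each of the N - 1 others; the
    inverse powers coming from the last factor are then distributed over [j]. *)
Lemma laurent_sum_potential u r (Y : coord N M.+1 -> C) : (forall i, Y i <> 0) ->
  laurent_sum u r (fun a b i => monomial_form a b (Y i)) =
  potential u Y ^ r * \cprod_(i : coord N M.+1) / Y i.
Proof.
move=> Y0; rewrite laurent_sum_factor potentialE // Cpow_mult_l cprod_pow.
rewrite multinomial_theorem.
set S := \big[Cmult/RtoC 1]_(j < N.-1) _.
set Q := \big[Cmult/RtoC 1]_i _.
have -> : forall T, S * T * Q = T * (S * Q) by move=> T; ring.
rewrite big_distrl; apply: eq_bigr => be _ /=.
have -> : \cprod_(k < M.+1) (tnth u k * \cprod_(j < N.-1) / extended_coord Y j k) ^ be k =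
   (\cprod_(k < M.+1) tnth u k ^ be k) *
   \cprod_(j < N.-1) \cprod_(k < M.+1) (/ extended_coord Y j k) ^ be k.
  rewrite exchange_big -big_split; apply: eq_bigr => k _ /=.
  by rewrite Cpow_mult_l cprod_pow.
rewrite -!Cmult_assoc; congr (_ * (_ * _)).
have -> : Q = \cprod_(j < N.-1) \cprod_(l < M) / Y (j, l).
  by rewrite pair_bigA; apply: eq_bigr => -[j l].
rewrite -!big_split; apply: eq_bigr => j _ /=.
rewrite multinomial_theorem big_distrl big_distrr; apply: eq_bigr => al _ /=.
(* Index 0 stands for the constant 1, so only the M genuine coordinates remain. *)
rewrite !big_ord_recl !extended_coord0.
have -> : / RtoC 1 = 1 by field.
rewrite !Cpow_1_l !Cmult_1_l.
set B := \big[Cmult/RtoC 1]_(l < M) (_ ^ be _).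
set A := \big[Cmult/RtoC 1]_(l < M) (_ ^ al _).
set Z := \big[Cmult/RtoC 1]_(l < M) / _.
transitivity (RtoC (multinom al) * (A * B * Z)); last by ring.
rewrite -!big_split; congr (_ * _); apply: eq_bigr => l _ /=.
by rewrite !extended_coord_lift.
Qed.

(** Agreement at the M nonzero indices together with equal weight forces agreement at index 0, so
    only [al = be] survives. *)
Lemma multinom_diagonal (r : nat) (be : {ffun 'I_M.+1 -> 'I_r.+1}) (c : C) :
  weight_pred be ->
  \csum_(al : {ffun 'I_M.+1 -> 'I_r.+1} | weight_pred al)
    (RtoC (multinom al) *
     \cprod_(l < M) (if al (lift ord0 l) == be (lift ord0 l) :> nat then c else RtoC 0)) =
  RtoC (multinom be) * c ^ M.
Proof.
move=> wbe; rewrite (bigD1 be) //= [X in _ + X]big1 => [|al /andP[wal albe]].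
  rewrite Cplus_0_r -cprod_const; congr (_ * _).
  by apply: eq_bigr => l _; rewrite eqxx.
have [/forallP alE|] := boolP [forall l : 'I_M, al (lift ord0 l) == be (lift ord0 l) :> nat].
  case/negP: albe; apply/eqP/ffunP => k; case: (unliftP ord0 k) => [l ->|->].
    exact/val_inj/eqP/alE.
  apply/val_inj; have := etrans (eqP wal) (esym (eqP wbe)); rewrite !big_ord_recl.
  rewrite (eq_bigr (fun l => be (lift ord0 l) : nat)) => [|l _].
    by move=> /eqP; rewrite eqn_add2r => /eqP.
  by rewrite (eqP (alE l)).
rewrite negb_forall => /existsP[l nl].
by rewrite (bigD1 l) //= (negbTE nl) Cmult_0_l Cmult_0_r.
Qed.

(** Each of the N - 1 factors contributes one coefficient [multinom be] and the last factor one
    more, whence the exponent N. *)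
Lemma laurent_sum_diagonal u (r : nat) (c : C) : (0 < N)%N ->
  laurent_sum u r (fun a b _ => if a == b then c else RtoC 0) =
  c ^ (N.-1 * M) *
  \csum_(be : {ffun 'I_M.+1 -> 'I_r.+1} | weight_pred be)
    (RtoC (multinom be) ^ N * \cprod_(k < M.+1) tnth u k ^ be k).
Proof.
move=> N0; rewrite laurent_sum_factor big_distrr; apply: eq_bigr => be wbe /=.
rewrite (eq_bigr (fun _ : 'I_N.-1 => RtoC (multinom be) * c ^ M)) => [|j _]; last first.
  exact: multinom_diagonal.
rewrite cprod_const Cpow_mult_l mulnC -multE Cpow_mult_r.
by rewrite -[in RtoC (multinom be) ^ N](prednK N0) Cpow_S; ring.
Qed.

(** Integration acts on a monomial coordinate by coordinate, so it merely changes the parameter [D]: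
    integrated coordinates get their residue value, the rest keep their monomial. *)
Lemma is_iter_circle_int_laurent_sum (eps : coord N M.+1 -> R) u r
    (s : seq (coord N M.+1)) (Y : coord N M.+1 -> C) :
  (forall i, (0 < eps i)%R) -> uniq s ->
  is_iter_circle_int eps
    (fun Z => laurent_sum u r (fun a b i => monomial_form a b (Z i))) s Y
    (laurent_sum u r (fun a b i =>
       if i \in s then if a == b then 2 * PI * Ci else RtoC 0
       else monomial_form a b (Y i))).
Proof.
move=> eps0 us.
apply: is_iter_circle_int_sum => be _; apply: is_iter_circle_int_scal.
apply: is_iter_circle_int_sum => A _; apply: is_iter_circle_int_scal.
pose g (i : coord N M.+1) :=
  monomial_form (A i.1 (lift ord0 i.2)) (be (lift ord0 i.2)).
apply: (is_iter_circle_int_prod (g := g)) => // i.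
exact: is_CInt_monomial_form.
Qed.

End Potential.

(** * Integration of the geometric series *)

Lemma Cmod_sum_le (I : Type) (s : seq I) (F : I -> C) (f : I -> R) :
  (forall i, (Cmod (F i) <= f i)%R) ->
  (Cmod (\big[Cplus/RtoC 0]_(i <- s) F i) <= \big[Rplus/0%R]_(i <- s) f i)%R.
Proof.
move=> Ff; elim/big_rec2: _ => [|i y x _ xy]; first by rewrite Cmod_0; lra.
by have := Cmod_triangle (F i) x; have := Ff i; lra.
Qed.

Lemma Cmod_prod_le (I : Type) (s : seq I) (F : I -> C) (f : I -> R) :
  (forall i, (Cmod (F i) <= f i)%R) ->
  (Cmod (\big[Cmult/RtoC 1]_(i <- s) F i) <= \big[Rmult/1%R]_(i <- s) f i)%R.
Proof.
move=> Ff; elim/big_rec2: _ => [|i y x _ xy]; first by rewrite Cmod_1; lra.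
by rewrite Cmod_mult; apply: Rmult_le_compat => //; apply: Cmod_ge_0.
Qed.

Lemma Cmod_prod (I : Type) (s : seq I) (F : I -> C) :
  Cmod (\big[Cmult/RtoC 1]_(i <- s) F i) = \big[Rmult/1%R]_(i <- s) Cmod (F i).
Proof. apply: (big_morph Cmod Cmod_mult); exact: Cmod_1. Qed.

Lemma Rsum_ge0 (I : Type) (s : seq I) (f : I -> R) :
  (forall i, (0 <= f i)%R) -> (0 <= \big[Rplus/0%R]_(i <- s) f i)%R.
Proof.
move=> f0; elim/big_rec: _ => [|i x _ x0]; first lra.
by have := f0 i; lra.
Qed.

Lemma Rprod_gt0 (I : Type) (s : seq I) (f : I -> R) :
  (forall i, (0 < f i)%R) -> (0 < \big[Rmult/1%R]_(i <- s) f i)%R.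
Proof.
move=> f0; elim/big_rec: _ => [|i x _ x0]; first lra.
exact: Rmult_lt_0_compat.
Qed.

Lemma geometric_remainder (p : C) (n : nat) : p <> 1 ->
  \csum_(r < n) p ^ r - / (1 - p) = - (p ^ n / (1 - p)).
Proof.
move=> p1; have q0 : 1 - p <> 0.
  by move=> h; apply: p1; have -> : p = 1 - (1 - p); [ring | rewrite h; ring].
elim: n => [|n IHn]; first by rewrite big_ord0 /=; field.
rewrite big_ord_recr Cpow_S /=.
have -> : \csum_(r < n) p ^ r = / (1 - p) - p ^ n / (1 - p).
  have E S : S = / (1 - p) + (S - / (1 - p)) by ring.
  by rewrite [LHS]E IHn; ring.
by field.
Qed.

Lemma one_minus_half (p : C) : (Cmod p <= / 2)%R -> (/ 2 <= Cmod (1 - p))%R.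
Proof.
move=> hp; have := Cmod_triangle (1 - p) p.
by rewrite /Cminus -Cplus_assoc (Cplus_comm (- p)) Cplus_opp_r Cplus_0_r Cmod_1; lra.
Qed.

(** Up to sign the remainder is p^n q / (1 - p), and |1 - p| is at least 1/2; this accounts for the
    factor 2. *)
Lemma geometric_remainder_bound (p q : C) (n : nat) : (Cmod p <= / 2)%R ->
  (Cmod (\csum_(r < n) (p ^ r * q) - / (1 - p) * q) <= 2 * (/ 2) ^ n * Cmod q)%R.
Proof.
move=> hp; have hq := one_minus_half hp.
have p1 : p <> 1 by move=> h; rewrite h Cmod_1 in hp; lra.
have q0 : 1 - p <> 0 by move=> h; rewrite h Cmod_0 in hq; lra.
rewrite -big_distrl /=.
have -> : forall S, S * q - / (1 - p) * q = (S - / (1 - p)) * q by move=> S; ring.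
rewrite geometric_remainder // Cmod_mult Cmod_opp Cmod_div // Cmod_pow.
apply: Rmult_le_compat_r; first exact: Cmod_ge_0.
rewrite Rmult_comm /Rdiv; apply: Rmult_le_compat.
- by apply: pow_le; apply: Cmod_ge_0.
- by apply/Rlt_le/Rinv_0_lt_compat; lra.
- by apply: pow_incr; split=> //; apply: Cmod_ge_0.
- by rewrite -[X in (_ <= X)%R]Rinv_inv; apply: Rinv_le_contravar; lra.
Qed.

Lemma sum_n_big (a : nat -> C) (n : nat) :
  sum_n (G := C_R_NormedModule) a n = \csum_(r < n.+1) a r.
Proof.
elim: n => [|n IHn]; first by rewrite sum_O big_ord_recr big_ord0 /= Cplus_0_l.
by rewrite sum_Sn IHn [RHS]big_ord_recr.
Qed.

Lemma is_series_C (a : nat -> C) (l : C) :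
  (forall e, (0 < e)%R -> exists n0, forall n, (n0 <= n)%N ->
     (Cmod (\csum_(r < n) a r - l) < e)%R) ->
  is_series (V := C_R_NormedModule) a l.
Proof.
move=> H; apply/filterlim_locally => e; have [n0 Hn0] := H e (cond_pos e).
exists n0 => n /leP n0n; apply: (norm_compat1 (V := C_R_NormedModule)).
(* [sum_n] includes its last index, so it has [n.+1] terms. *)
rewrite sum_n_big; have := Hn0 n.+1 (leqW n0n).
by rewrite Cmod_norm.
Qed.

Section PeriodSeries.

Variables (N M : nat) (eps : coord N M.+1 -> R).
Hypothesis eps_gt0 : forall i, (0 < eps i)%R.

Lemma on_torus_neq0 (Y : coord N M.+1 -> C) : on_torus eps Y ->
  forall i, Y i <> 0.
Proof. by move=> tY i h; have := eps_gt0 i; rewrite -tY h Cmod_0; lra. Qed.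

(** Only the last factor involves [u], and linearly, so on the torus the bound is linear in [d] with
    a constant fixed by the radii. *)
Lemma potential_bound : exists B : R, (0 < B)%R /\
  forall (d : R) (u : M.+1.-tuple C) (Y : coord N M.+1 -> C), on_torus eps Y ->
    (forall k, (Cmod (tnth u k) <= d)%R) -> (Cmod (potential u Y) <= B * d)%R.
Proof.
(* [A] bounds the product of the N - 1 factors; [S] times [d] bounds the last one. *)
pose A := \big[Rmult/1%R]_(j < N.-1) (1 + \big[Rplus/0%R]_(l < M) eps (j, l))%R.
pose q l := \big[Rmult/1%R]_(j < N.-1) eps (j, l).
pose S := (1 + \big[Rplus/0%R]_(l < M) (/ q l))%R.
have q0 l : (0 < q l)%R by apply: Rprod_gt0.
have A0 : (0 < A)%R.
  apply: Rprod_gt0 => j; apply: Rplus_lt_le_0_compat; first lra.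
  by apply: Rsum_ge0 => l; apply/Rlt_le.
have S0 : (0 < S)%R.
  apply: Rplus_lt_le_0_compat; first lra.
  by apply: Rsum_ge0 => l; apply/Rlt_le/Rinv_0_lt_compat.
exists (A * S)%R; split; first exact: Rmult_lt_0_compat.
move=> d u Y tY ud; have Y0 := on_torus_neq0 tY.
rewrite Cmod_mult Rmult_assoc; apply: Rmult_le_compat; try exact: Cmod_ge_0.
  apply: Cmod_prod_le => j; apply: Rle_trans (Cmod_triangle _ _) _.
  rewrite Cmod_1; apply: Rplus_le_compat_l; apply: Cmod_sum_le => l.
  by rewrite tY; lra.
apply: Rle_trans (Cmod_triangle _ _) _; rewrite Rmult_plus_distr_r Rmult_1_l.
apply: Rplus_le_compat; first by have := ud ord0; rewrite (tnth_nth (RtoC 0)).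
elim/big_rec2: _ => [|l x y _ xy]; first by rewrite Cmod_0; lra.
apply: Rle_trans (Cmod_triangle _ _) _; rewrite Rmult_plus_distr_r.
apply: Rplus_le_compat => //.
rewrite Cmod_div; last by apply: cprod_neq0.
have -> : Cmod (\cprod_(j < N.-1) Y (j, l)) = q l.
  by rewrite Cmod_prod; apply: eq_bigr => j _; apply: tY.
rewrite /Rdiv Rmult_comm; apply: Rmult_le_compat_l; first exact/Rlt_le/Rinv_0_lt_compat.
by have := ud (lift ord0 l); rewrite (tnth_nth (RtoC 0)) lift0.
Qed.

Lemma period_series (u : M.+1.-tuple C) : (0 < N)%N ->
  (forall Y, on_torus eps Y -> (Cmod (potential u Y) <= / 2)%R) ->
  ex_torus_int eps (period_integrand (N := N) u) /\
  is_series (V := C_R_NormedModule)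
    (fun r => \csum_(be : {ffun 'I_M.+1 -> 'I_r.+1} | weight_pred be)
       (RtoC (multinom be) ^ N * \cprod_(k < M.+1) tnth u k ^ be k))
    (period eps u).
Proof.
move=> N0 hu.
pose Fn n Y := \csum_(r < n) laurent_sum u r
  (fun a b (i : coord N M.+1) => monomial_form a b (Y i)).
pose E := \big[Rmult/1%R]_(i : coord N M.+1) (/ eps i)%R.
have E0 : (0 < E)%R by apply: Rprod_gt0 => i; apply: Rinv_0_lt_compat.
have limF e : (0 < e)%R -> exists n0, forall n, (n0 <= n)%N ->
    forall Y, on_torus eps Y -> (Cmod (Fn n Y - period_integrand u Y) < e)%R.
  (* The remainder is at most 2 (1/2)^n E, hence the threshold e / (2E). *)
  move=> e0; have [||n0 Hn0] := pow_lt_1_zero (/ 2)%R _ (e / (2 * E))%R.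
  - rewrite Rabs_pos_eq; lra.
  - by apply: Rdiv_lt_0_compat => //; lra.
  exists n0 => n n0n Y tY; have Y0 := on_torus_neq0 tY.
  have -> : Fn n Y = \csum_(r < n) (potential u Y ^ r * \cprod_(i : coord N M.+1) / Y i).
    by apply: eq_bigr => r _; apply: laurent_sum_potential.
  apply: Rle_lt_trans (geometric_remainder_bound _ _ (hu Y tY)) _.
  have -> : Cmod (\cprod_(i : coord N M.+1) / Y i) = E.
    by rewrite Cmod_prod; apply: eq_bigr => i _; rewrite Cmod_inv // tY.
  have := Hn0 n (elimT leP n0n); rewrite Rabs_pos_eq => [H|]; last first.
    by apply: pow_le; lra.
  have -> : e = (2 * (e / (2 * E)) * E)%R by field; lra.
  by apply: Rmult_lt_compat_r => //; lra.
have Fint n s Y : uniq s -> is_iter_circle_int eps (Fn n) s Y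
    (\csum_(r < n) laurent_sum u r (fun a b i =>
       if i \in s then if a == b then 2 * PI * Ci else RtoC 0
       else monomial_form a b (Y i))).
  move=> us; apply: is_iter_circle_int_sum => r _.
  exact: is_iter_circle_int_laurent_sum.
have exFn n s Y : uniq s -> ex_iter_circle_int eps (Fn n) s Y.
  by move=> us; have [] := Fint n s Y us.
have [exF limI] := is_iter_circle_int_uniform_limit eps_gt0 exFn limF (enum_uniq (coord N M.+1)).
(* All coordinates get integrated, so the torus condition on the base point 0 is vacuous. *)
have off0 : on_torus_off eps (enum (coord N M.+1)) (fun=> RtoC 0).
  by move=> i; rewrite mem_enum.
split; first exact: exF.
set K := (2 * PI * Ci) ^ (N.-1 * M).
have K0 : K <> 0.
  apply: Cpow_nz; apply: Cmult_neq_0; last first.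
    by move=> h; have := Cmod_Ci; rewrite h Cmod_0; lra.
  by rewrite -RtoC_mult => /RtoC_inj; have := PI_RGT_0; lra.
apply: is_series_C => e e0.
have cK : (0 < Cmod K)%R by apply/Cmod_gt_0.
(* The period divides by [K], so the tolerance is scaled by its modulus. *)
have [|n0 Hn0] := limI (e * Cmod K)%R; first exact: Rmult_lt_0_compat.
exists n0 => n n0n; have := Hn0 n n0n _ off0.
rewrite (Fint n _ _ (enum_uniq (coord N M.+1))).2.
set S := \csum_(r < n) laurent_sum _ _ _.
set T := \csum_(r < n) _.
(* Every coordinate has been integrated, leaving only diagonal terms; each coordinate contributes 2
   pi i, which makes up [K]. *)
have -> : S = K * T.
  rewrite big_distrr; apply: eq_bigr => r _ /=; rewrite -laurent_sum_diagonal //.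
  apply: eq_bigr => be _; congr (_ * _); apply: eq_bigr => al _; congr (_ * _).
  by apply: eq_bigr => i _; rewrite mem_enum.
rewrite -/(torus_int _ _) => H.
have -> : T - period eps u = / K * (K * T - torus_int eps (period_integrand u)).
  by rewrite /period -/K; field.
rewrite Cmod_mult Cmod_inv //.
have -> : e = (/ Cmod K * (e * Cmod K))%R by field; lra.
by apply: Rmult_lt_compat_l => //; apply: Rinv_0_lt_compat.
Qed.

End PeriodSeries.

Theorem theorem3p1 (N m : nat) (hN : (2 <= N)%N) (hm : (2 <= m)%N)
    (eps : coord N m -> R) (eps_gt0 : forall i, (0 < eps i)%R) :
  exists delta : R, (0 < delta)%R /\
    forall (x : m.-tuple C) (z : C), z <> RtoC 0 ->
      (forall k : 'I_m, (Cmod (tnth x k / z) < delta)%R) ->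
      let u : m.-tuple C := [tuple (tnth x k / z)%C | k < m] in
      (* the integrand has no pole on the torus, the integral exists, and the
         series converges to the period *)
      (forall Y : coord N m -> C, on_torus eps Y -> W u (RtoC 1) Y <> RtoC 0) /\
      ex_torus_int eps (period_integrand (N := N) u) /\
      is_series (V := C_R_NormedModule) (period_term N x z) (period eps u).
Proof.
case: m hm eps eps_gt0 => // M hm eps eps_gt0.
have [B [B0 HB]] := potential_bound eps_gt0.
(* With this radius the bound B d on P equals 1/2. *)
exists (/ (2 * B))%R; split; first by apply: Rinv_0_lt_compat; lra.
move=> x z z0 xz u.
have hu Y : on_torus eps Y -> (Cmod (potential u Y) <= / 2)%R.
  move=> tY; have -> : (/ 2 = B * / (2 * B))%R by field; lra.
  by apply: HB => // k; rewrite tnth_mktuple; apply/Rlt_le.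
split.
  move=> Y tY; have := one_minus_half (hu Y tY); rewrite -/(W u 1 Y) => h hW.
  by rewrite hW Cmod_0 in h; lra.
have [exI series] := period_series eps_gt0 (ltnW hN) hu; split=> //.
apply: is_series_ext series => r; apply: eq_bigr => be /eqP wbe.
congr (_ * _).
(* The exponents sum to [r], so z^r can be shared out among the quotients x_k / z. *)
have -> : z ^ r = \cprod_(k < M.+1) z ^ be k.
  rewrite -[in LHS]wbe; apply: (big_morph (fun n => z ^ n)) => // a b.
  by rewrite -plusE Cpow_add_r.
rewrite /Cdiv -cprod_inv => [|k]; last exact: Cpow_nz.
rewrite -big_split; apply: eq_bigr => k _ /=.
by rewrite tnth_mktuple Cpow_mult_l Cpow_inv.
Qed.
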